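(* Let $\mathfrak{T}$ and $\mathfrak{S}$ be $\mathcal{L}_1$-trees and let $\mathfrak{F}$ and $\mathfrak{G}$ be $\mathcal{L}_2$-forests. Let $A$ and $B$ be paths in $\mathfrak{T}$ and $\mathfrak{S}$ respectively. If $(\mathfrak{T};A)\equiv^n(\mathfrak{S};B)$ and $\mathfrak{F}\equiv^n\mathfrak{G}$ then $\left(\mathfrak{T}+_A\mathfrak{F};A\right)\equiv^n\left(\mathfrak{S}+_B\mathfrak{G};B\right)$.
   Context: A tree is a structure $\mathfrak{T}=(T;<)$ with $T$ non-empty and $<$ a strict partial order that is downwards linear (each set $\{x : x \leqslant t\}$ is totally ordered) and downwards connected (for all $s,t$ there is $x$ with $x\leqslant s$ and $x\leqslant t$). A forest is a strict partial order that is downwards linear (a disjoint union of trees). The language of a tree or forest consists of $=$, $<$ and finitely many constants and unary predicates; an $\mathcal{L}$-tree ($\mathcal{L}$-forest) is one in the language $\mathcal{L}$. A path is a maximal linearly ordered subset. $(\mathfrak{T};A)$ is the expansion of $\mathfrak{T}$ by a unary predicate for $A$. $\equiv^n$ denotes agreement on all first-order sentences of quantifier rank at most $n$ ($n$ a natural number). For a tree $\mathfrak{T}$, a forest $\mathfrak{F}$ and a path $L$ in $\mathfrak{T}$, the sum $\mathfrak{T}+_L\mathfrak{F}$ has underlying set $(T\times\{0\})\cup(F\times\{1\})$ and order $$\{((x,0),(y,0)) : x<_{\mathfrak{T}}y\}\cup\{((x,1),(y,1)) : x<_{\mathfrak{F}}y\}\cup\{((x,0),(y,1)) : x\in L,\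 y\in F\}.$$ Each constant $a$ of $\mathfrak{T}$ (resp. $\mathfrak{F}$) gives a constant $(a,0)$ (resp. $(a,1)$) of the sum, and each predicate $P$ of $\mathfrak{T}$ (resp. $\mathfrak{F}$) gives a predicate $P\times\{0\}$ (resp. $P\times\{1\}$) of the sum (constant and predicate symbols coming from the two summands being kept distinct). In $(\mathfrak{T}+_A\mathfrak{F};A)$ the predicate $A$ stands for $A\times\{0\}$. *)

(* Defs.v *)
From Corelib Require Export RelationClasses.
From mathcomp Require Export all_boot.
From mathcomp Require Export classical_sets.

Set Implicit Arguments.
Unset Strict Implicit.
Unset Printing Implicit Defensive.

Local Open Scope classical_set_scope.

(* Every language has the logical symbol = and the binary symbol <; a value of
   [language] lists the remaining symbols. *)
Record language := Language {
  const_symb : finType;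
  pred_symb : finType
}.

Record structure (L : language) := Structure {
  carrier :> Type;
  lt : carrier -> carrier -> Prop;
  const_val : const_symb L -> carrier;
  pred_val : pred_symb L -> set carrier
}.

Definition le (L : language) (M : structure L) (x y : M) : Prop :=
  x = y \/ lt x y.

Definition downward_linear (L : language) (M : structure L) : Prop :=
  forall t : M, total_on [set x : M | le x t] (@le L M).

Definition downward_connected (L : language) (M : structure L) : Prop :=
  forall s t : M, exists x : M, le x s /\ le x t.

(* A forest may be empty, a tree may not. *)
Definition is_forest (L : language) (M : structure L) : Prop :=
  StrictOrder (@lt L M) /\ downward_linear M.

Definition is_tree (L : language) (M : structure L) : Prop :=
  [/\ inhabited M, StrictOrder (@lt L M), downward_linear M
    & downward_connected M].

Definition is_path (L : language) (M : structure L) (A : set M) : Prop :=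
  total_on A (@le L M) /\
  forall B : set M, total_on B (@le L M) -> A `<=` B -> B = A.
Arguments is_path {L} M A.

Definition expand_language (L : language) : language :=
  Language (const_symb L) (option (pred_symb L)).

(* (M; A): the new predicate symbol is [None]. *)
Definition expand (L : language) (M : structure L) (A : set M) :
    structure (expand_language L) :=
  @Structure (expand_language L) M (@lt L M) (@const_val L M)
    (fun P => if P is Some Q then pred_val Q else A).
Arguments expand {L} M A.

Definition sum_language (L1 L2 : language) : language :=
  Language (const_symb L1 + const_symb L2)%type
           (pred_symb L1 + pred_symb L2)%type.

Definition sum_lt (L1 L2 : language) (T : structure L1) (F : structure L2)
    (A : set T) (u v : T + F) : Prop :=
  match u, v with
  | inl x, inl y => lt x y
  | inr x, inr y => lt x y
  | inl x, inr _ => A x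
  | inr _, inl _ => False
  end.

(* T +_A F, with (x, 0) encoded as [inl x] and (y, 1) as [inr y]. *)
Definition tree_sum (L1 L2 : language) (T : structure L1) (A : set T)
    (F : structure L2) : structure (sum_language L1 L2) :=
  @Structure (sum_language L1 L2) (T + F)%type (@sum_lt L1 L2 T F A)
    (fun c => match c with
              | inl a => inl (const_val T a)
              | inr a => inr (const_val F a)
              end)
    (fun P => match P with
              | inl Q => inl @` pred_val Q
              | inr Q => inr @` pred_val Q
              end).
Arguments tree_sum {L1 L2} T A F.

(* Well-scoped de Bruijn syntax: [formula L k] has its free variables among
   0, ..., k-1, and a quantifier binds variable 0 of its body. Sentences are
   thus meaningful in the empty structure as well. *)
Inductive term (L : language) (k : nat) : Type :=
| Var of 'I_k
| Const of const_symb L.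

Inductive formula (L : language) : nat -> Type :=
| Bot k : formula L k
| Eq k : term L k -> term L k -> formula L k
| Lt k : term L k -> term L k -> formula L k
| Pred k : pred_symb L -> term L k -> formula L k
| Not k : formula L k -> formula L k
| And k : formula L k -> formula L k -> formula L k
| Or k : formula L k -> formula L k -> formula L k
| Imp k : formula L k -> formula L k -> formula L k
| All k : formula L k.+1 -> formula L k
| Ex k : formula L k.+1 -> formula L k.

Notation sentence L := (formula L 0).

Fixpoint quantifier_rank (L : language) (k : nat) (phi : formula L k) : nat :=
  match phi with
  | Bot _ | Eq _ _ _ | Lt _ _ _ | Pred _ _ _ => 0
  | Not _ p => quantifier_rank p
  | And _ p q | Or _ p q | Imp _ p q =>
      maxn (quantifier_rank p) (quantifier_rank q)
  | All _ p | Ex _ p => (quantifier_rank p).+1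
  end.

Definition term_val (L : language) (M : structure L) (k : nat)
    (e : k.-tuple M) (t : term L k) : M :=
  match t with
  | Var i => tnth e i
  | Const c => const_val M c
  end.

Fixpoint sat (L : language) (M : structure L) (k : nat) (phi : formula L k) :
    k.-tuple M -> Prop :=
  match phi in formula _ k return k.-tuple M -> Prop with
  | Bot _ => fun _ => False
  | Eq _ s t => fun e => term_val e s = term_val e t
  | Lt _ s t => fun e => lt (term_val e s) (term_val e t)
  | Pred _ P t => fun e => pred_val P (term_val e t)
  | Not _ p => fun e => ~ sat p e
  | And _ p q => fun e => sat p e /\ sat q e
  | Or _ p q => fun e => sat p e \/ sat q e
  | Imp _ p q => fun e => sat p e -> sat q e
  | All _ p => fun e => forall x : M, sat p [tuple of x :: e]
  | Ex _ p => fun e => exists x : M, sat p [tuple of x :: e]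
  end.

Definition models (L : language) (M : structure L) (phi : sentence L) : Prop :=
  sat phi [tuple of [::] : seq M].

Definition elem_equiv (n : nat) (L : language) (M N : structure L) : Prop :=
  forall phi : sentence L,
    quantifier_rank phi <= n -> (models M phi <-> models N phi).

(* Main.v *)
Require Import Defs.
From mathcomp Require Import boolp.

Local Open Scope classical_set_scope.

(** Ehrenfeucht-Fraisse games: for a finite language, agreement up to quantifier
    rank n is the same as Duplicator having a winning strategy in the n-round
    game. In the game on the two sums, Duplicator answers a move in the tree
    part with her strategy for the expanded trees, and a move in the forest part
    with her strategy for the forests. The order between the two parts is
    determined by membership in the path, which the expanded trees record. *)

Set Implicit Arguments.
Unset Strict Implicit.
Unset Printing Implicit Defensive.

(** * Game positions and winning strategies *)

(** The equality clause makes [R] a partial injection. Constants have no clause of their own: they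
    enter as pairs of the opening position. *)
Definition partial_iso (L : language) (M N : structure L)
    (R : M -> N -> Prop) : Prop :=
  forall x x' y y', R x y -> R x' y' ->
    [/\ x = x' <-> y = y', lt x x' <-> lt y y'
      & forall P, pred_val P x <-> pred_val P y].

Definition add_pair (X Y : Type) (R : X -> Y -> Prop) (x : X) (y : Y) :
    X -> Y -> Prop :=
  fun x' y' => R x' y' \/ (x' = x /\ y' = y).

(** Duplicator wins with [n] rounds left from the position [R]. Positions are relations rather than
    tuples, so they can be compared by inclusion. *)
Fixpoint back_forth (L : language) (M N : structure L) (n : nat)
    (R : M -> N -> Prop) : Prop :=
  partial_iso R /\
  if n is m.+1 then
    (forall x, exists y, back_forth m (add_pair R x y)) /\
    (forall y, exists x, back_forth m (add_pair R x y))
  else True.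

Lemma back_forth_iso (L : language) (M N : structure L) (n : nat)
    (R : M -> N -> Prop) : back_forth n R -> partial_iso R.
Proof. by case: n => [|n] []. Qed.

(** Fewer pairs impose fewer constraints, so the answers that win from the larger position still
    win. *)
Lemma back_forth_sub (L : language) (M N : structure L) (n : nat)
    (R R' : M -> N -> Prop) :
  (forall x y, R' x y -> R x y) -> back_forth n R -> back_forth n R'.
Proof.
elim: n R R' => [|n IHn] R R' sub [iso H]; split=> //.
- by move=> x x' y y' /sub Rxy /sub; apply: iso.
- by move=> x x' y y' /sub Rxy /sub; apply: iso.
have subU x y x' y' : add_pair R' x y x' y' -> add_pair R x y x' y'.
  by case=> [/sub|]; [left | right].
case: H => forth back; split=> [x | y].
- by have [y Hy] := forth x; exists y; apply: IHn Hy; apply: subU.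
- by have [x Hx] := back y; exists x; apply: IHn Hx; apply: subU.
Qed.

Lemma back_forthW (L : language) (M N : structure L) (n : nat)
    (R : M -> N -> Prop) : back_forth n.+1 R -> back_forth n R.
Proof.
elim: n R => [|n IHn] R [iso [forth back]]; split=> //; split=> [x|y].
- by have [y Hy] := forth x; exists y; apply: IHn.
- by have [x Hx] := back y; exists x; apply: IHn.
Qed.

(** Each quantifier costs one round: the element it ranges over is a move of Spoiler, and the answer
    serves as the matching element of the other structure. *)
Lemma back_forth_sat (L : language) (M N : structure L) (k : nat)
    (phi : formula L k) (n : nat) (R : M -> N -> Prop)
    (e : k.-tuple M) (f : k.-tuple N) :
  (forall c, R (const_val M c) (const_val N c)) ->
  (forall i, R (tnth e i) (tnth f i)) ->
  back_forth n R -> quantifier_rank phi <= n -> (sat phi e <-> sat phi f).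
Proof.
move=> Rc.
have Rt j (g : j.-tuple M) (h : j.-tuple N) (Q : M -> N -> Prop) t :
    (forall c, Q (const_val M c) (const_val N c)) ->
    (forall i, Q (tnth g i) (tnth h i)) -> Q (term_val g t) (term_val h t).
  by case: t => [i|c] Qc Qgh; [apply: Qgh | apply: Qc].
have Rcons j (g : j.-tuple M) (h : j.-tuple N) (Q : M -> N -> Prop) x y :
    (forall i, Q (tnth g i) (tnth h i)) ->
    forall i, add_pair Q x y (tnth [tuple of x :: g] i) (tnth [tuple of y :: h] i).
  move=> Qgh i; case: (unliftP ord0 i) => [i' ->|->].
    by rewrite !tnthS; left.
  by rewrite !tnth0; right.
move: n R e f Rc; elim: phi =>
  [j|j s t|j s t|j P t|j p IHp|j p IHp q IHq|j p IHp q IHq|j p IHp q IHq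
  |j p IHp|j p IHp] n R e f Rc Re bf /=.
- by [].
- by have [] := back_forth_iso bf (Rt _ _ _ _ s Rc Re) (Rt _ _ _ _ t Rc Re).
- by have [] := back_forth_iso bf (Rt _ _ _ _ s Rc Re) (Rt _ _ _ _ t Rc Re).
- by have [] := back_forth_iso bf (Rt _ _ _ _ t Rc Re) (Rt _ _ _ _ t Rc Re).
- by move=> /(IHp _ _ _ _ Rc Re bf) ->.
- by rewrite geq_max => /andP[/(IHp _ _ _ _ Rc Re bf) -> /(IHq _ _ _ _ Rc Re bf) ->].
- by rewrite geq_max => /andP[/(IHp _ _ _ _ Rc Re bf) -> /(IHq _ _ _ _ Rc Re bf) ->].
- by rewrite geq_max => /andP[/(IHp _ _ _ _ Rc Re bf) -> /(IHq _ _ _ _ Rc Re bf) ->].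
(* The rank is positive, so a round remains. An instance on one side follows from the instance at
   Duplicator's answer on the other. *)
- case: n bf => [|n] // [_ [forth back]] rk; split=> H.
  + move=> y; have [x bfx] := back y.
    by apply/(IHp _ _ [tuple of x :: e] _ _ (Rcons _ _ _ _ _ _ Re) bfx rk) => // c; left.
  + move=> x; have [y bfy] := forth x.
    by apply/(IHp _ _ _ [tuple of y :: f] _ (Rcons _ _ _ _ _ _ Re) bfy rk) => // c; left.
- case: n bf => [|n] // [_ [forth back]] rk; split=> [[x Hx]|[y Hy]].
  + have [y bfy] := forth x; exists y.
    by apply/(IHp _ _ [tuple of x :: e] _ _ (Rcons _ _ _ _ _ _ Re) bfy rk) => // c; left.
  + have [x bfx] := back y; exists x.
    by apply/(IHp _ _ _ [tuple of y :: f] _ (Rcons _ _ _ _ _ _ Re) bfx rk) => // c; left.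
Qed.

(** * Describing positions by finitely many formulas *)

(** The position after the moves [e] and [f]: the chosen pairs, as values of variables, and the
    pairs of constants. *)
Definition term_rel (L : language) (M N : structure L) (k : nat)
    (e : k.-tuple M) (f : k.-tuple N) (x : M) (y : N) : Prop :=
  exists t, x = term_val e t /\ y = term_val f t.

Lemma add_pair_term_rel (L : language) (M N : structure L) (k : nat)
    (e : k.-tuple M) (f : k.-tuple N) (x x' : M) (y y' : N) :
  add_pair (term_rel e f) x y x' y' ->
  term_rel [tuple of x :: e] [tuple of y :: f] x' y'.
Proof.
case=> [[[i|c] [-> ->]]|[-> ->]].
- by exists (Var _ (lift ord0 i)); rewrite /= !tnthS.
- by exists (Const _ c).
- by exists (Var _ ord0).
Qed.

Definition conj_formula (L : language) (k : nat) (s : seq (formula L k)) :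
    formula L k :=
  foldr (@And L k) (Not (Bot L k)) s.

Lemma sat_conj_formula (L : language) (M : structure L) (k : nat) (I : eqType)
    (h : I -> formula L k) (s : seq I) (e : k.-tuple M) :
  sat (conj_formula (map h s)) e <-> forall i, i \in s -> sat (h i) e.
Proof.
elim: s => [|i s IHs] /=; first by split=> // _ [].
rewrite IHs; split=> [[Hi Hs] j|H].
  by rewrite in_cons => /predU1P[->|/Hs].
by split=> [|j js]; apply: H; rewrite in_cons ?eqxx ?js ?orbT.
Qed.

Lemma conj_formula_rank (L : language) (k n : nat) (I : Type)
    (h : I -> formula L k) (s : seq I) :
  (forall i, quantifier_rank (h i) <= n) ->
  quantifier_rank (conj_formula (map h s)) <= n.
Proof. by move=> hn; elim: s => //= i s IHs; rewrite geq_max hn. Qed.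

Definition sign_formula (L : language) (k : nat) (I : finType)
    (h : I -> formula L k) (s : {set I}) (i : I) : formula L k :=
  if i \in s then h i else Not (h i).

(** One step of a Hintikka formula: some further element realises exactly those formulas [h i] with
    [i] in [s]. *)
Definition extension_formula (L : language) (k : nat) (I : finType)
    (h : I -> formula L k.+1) (s : {set I}) : formula L k :=
  Ex (conj_formula (map (sign_formula h s) (enum I))).

Lemma extension_formula_forth (L : language) (M N : structure L) (k : nat)
    (I : finType) (h : I -> formula L k.+1) (e : k.-tuple M) (f : k.-tuple N)
    (x : M) :
  (forall s, sat (extension_formula h s) e -> sat (extension_formula h s) f) ->
  exists y : N, forall i,
    sat (h i) [tuple of x :: e] <-> sat (h i) [tuple of y :: f].
Proof.
move=> ef.
(* The type of [x] over [e]; its extension formula holds at [e] with witness [x], and a witness at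
   [f] is the required [y]. *)
pose s := [set i | `[< sat (h i) [tuple of x :: e] >] ]%SET.
have [|y /sat_conj_formula Hy] := ef s.
  exists x; apply/sat_conj_formula => i _; rewrite /sign_formula inE.
  by case: asboolP.
exists y => i; have := Hy i (mem_enum _ _); rewrite /sign_formula inE.
by case: asboolP.
Qed.

(** Codes terms by a sum of finite types, so that the atoms are indexed by a [finType]. *)
Definition term_of (L : language) (k : nat) (u : 'I_k + const_symb L) :
    term L k :=
  match u with inl i => Var L i | inr c => Const k c end.

Lemma term_ofP (L : language) (k : nat) (t : term L k) :
  exists u, t = term_of u.
Proof. by case: t => [i|c]; [exists (inl i) | exists (inr c)]. Qed.

Definition atom_index (L : language) (k : nat) : finType :=
  let U := ('I_k + const_symb L)%type in (U * U + U * U + pred_symb L * U)%type.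

Definition atom (L : language) (k : nat) (a : atom_index L k) : formula L k :=
  match a with
  | inl (inl (u, v)) => Eq (term_of u) (term_of v)
  | inl (inr (u, v)) => Lt (term_of u) (term_of v)
  | inr (P, u) => Pred P (term_of u)
  end.

Lemma atom_partial_iso (L : language) (M N : structure L) (k : nat)
    (e : k.-tuple M) (f : k.-tuple N) :
  (forall a, sat (@atom L k a) e <-> sat (@atom L k a) f) ->
  partial_iso (term_rel e f).
Proof.
move=> ef _ _ _ _ [t [-> ->]] [t' [-> ->]].
have [[u ->] [v ->]] := (term_ofP t, term_ofP t'); split=> [||P].
- exact: ef (inl (inl (u, v))).
- exact: ef (inl (inr (u, v))).
- exact: ef (inr (P, u)).
Qed.

(* Finiteness of the language enters here, through the finite type of atoms. *)
Lemma finite_rank_basis (L : language) (n k : nat) :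
  exists (I : finType) (h : I -> formula L k),
    (forall i, quantifier_rank (h i) <= n) /\
    forall (M N : structure L) (e : k.-tuple M) (f : k.-tuple N),
      (forall i, sat (h i) e <-> sat (h i) f) -> back_forth n (term_rel e f).
Proof.
elim: n k => [|n IHn] k.
  exists (atom_index L k), (@atom L k); split=> [[[[u v]|[u v]]|[P u]]|M N e f ef] //.
  by split=> //; apply: atom_partial_iso.
have [I [h [hn bf]]] := IHn k.+1.
(* Atoms control the present position; one extension formula for each subset of the basis in [k.+1]
   variables controls the next move. *)
exists (atom_index L k + {set I})%type.
exists (fun i => match i with
                 | inl a => atom a
                 | inr s => extension_formula h s end).
split=> [[[[[u v]|[u v]]|[P u]]|s]|M N e f ef] //=.
  rewrite ltnS; apply: conj_formula_rank => i.
  by rewrite /sign_formula; case: ifP => _; apply: hn.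
split; first by apply: atom_partial_iso => a; apply: ef (inl a).
split=> [x|y].
- have [s /(ef (inr s)) //|y Hy] := @extension_formula_forth L M N k I h e f x.
  exists y; apply: back_forth_sub (bf _ _ _ _ Hy) => x' y' H.
  exact: add_pair_term_rel H.
(* The back move is the forth move with the two structures exchanged. *)
- have [s /(ef (inr s)) //|x Hx] := @extension_formula_forth L N M k I h f e y.
  exists x; apply: back_forth_sub (bf _ _ _ _ (fun i => iff_sym (Hx i))) => x' y' H.
  exact: add_pair_term_rel H.
Qed.

Definition const_rel (L : language) (M N : structure L) (x : M) (y : N) : Prop :=
  exists c, x = const_val M c /\ y = const_val N c.

(** The Ehrenfeucht-Fraisse theorem. From left to right, the basis for [k = 0] consists of sentences
    of rank at most [n], on which the structures agree. *)
Lemma elem_equiv_back_forth (L : language) (M N : structure L) (n : nat) :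
  elem_equiv n M N <-> back_forth n (@const_rel L M N).
Proof.
split=> [MN|bf phi rk].
- have [I [h [hn bf]]] := finite_rank_basis L n 0.
  apply: back_forth_sub (bf _ _ _ _ (fun i => MN (h i) (hn i))) => x y [c [-> ->]].
  by exists (Const _ c).
- by apply: back_forth_sat bf rk => [c|[]//]; exists c.
Qed.

(** * Combining strategies on the sum *)

Definition sum_rel (X Y X' Y' : Type) (R : X -> Y -> Prop) (R' : X' -> Y' -> Prop)
    (u : X + X') (v : Y + Y') : Prop :=
  match u, v with
  | inl x, inl y => R x y
  | inr x, inr y => R' x y
  | _, _ => False
  end.

Lemma image_inl_iff (X X' Y Y' : Type) (P : set X) (P' : set X') (x : X) (x' : X') :
  (P x <-> P' x') -> ((@inl X Y) @` P) (inl x) <-> ((@inl X' Y') @` P') (inl x').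
Proof.
by move=> PP'; split=> -[z Pz [zE]]; [exists x' | exists x] => //; apply/PP'; rewrite -zE.
Qed.

Lemma image_inr_iff (X X' Y Y' : Type) (P : set Y) (P' : set Y') (y : Y) (y' : Y') :
  (P y <-> P' y') -> ((@inr X Y) @` P) (inr y) <-> ((@inr X' Y') @` P') (inr y').
Proof.
by move=> PP'; split=> -[z Pz [zE]]; [exists y' | exists y] => //; apply/PP'; rewrite -zE.
Qed.

Section TreeSum.

Variables (L1 L2 : language) (T S : structure L1) (F G : structure L2).
Variables (A : set T) (B : set S).

Let TA := expand T A.
Let SB := expand S B.
Let TF := expand (tree_sum T A F) (inl @` A).
Let SG := expand (tree_sum S B G) (inl @` B).

Lemma tree_sum_partial_iso (R : TA -> SB -> Prop) (Q : F -> G -> Prop) :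
  partial_iso R -> partial_iso Q ->
  @partial_iso _ TF SG (sum_rel R Q).
Proof.
move=> isoR isoQ.
have eq_inl X Y (x x' : X) : inl Y x = inl x' <-> x = x'.
  by split=> [[]|->].
have eq_inr X Y (y y' : Y) : inr X y = inr y' <-> y = y'.
  by split=> [[]|->].
have predR x y P : R x y -> @pred_val _ TF P (inl x) <-> @pred_val _ SG P (inl y).
  move=> Rxy; have [_ _ RP] := isoR _ _ _ _ Rxy Rxy.
  case: P => [[P|P]|].
  - exact: (image_inl_iff F G (RP (Some P) : pred_val P x <-> pred_val P y)).
  - by split=> -[].
  - exact: (image_inl_iff F G (RP None : A x <-> B y)).
have predQ x y P : Q x y -> @pred_val _ TF P (inr x) <-> @pred_val _ SG P (inr y).
  move=> Qxy; have [_ _ QP] := isoQ _ _ _ _ Qxy Qxy.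
  case: P => [[P|P]|].
  - by split=> -[].
  - exact: (image_inr_iff T S (QP P)).
  - by split=> -[].
move=> [x|x] [x'|x'] [y|y] [y'|y'] //= H H'; split=> [||P];
  try (by apply: predR); try (by apply: predQ); try (by []).
- by rewrite !eq_inl; have [] := isoR _ _ _ _ H H'.
- by have [] := isoR _ _ _ _ H H'.
(* A tree point lies below a forest point exactly when it is on the path, and [None] is the
   predicate symbol for the path. *)
- by have [_ _ /(_ None)] := isoR _ _ _ _ H H.
- by rewrite !eq_inr; have [] := isoQ _ _ _ _ H H'.
- by have [] := isoQ _ _ _ _ H H'.
Qed.

(** Each move is answered in the summand where it is made. The game on the other summand then has a
    round to spare, which [back_forthW] drops. *)
Lemma tree_sum_back_forth (n : nat) (R : TA -> SB -> Prop) (Q : F -> G -> Prop) :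
  back_forth n R -> back_forth n Q ->
  @back_forth _ TF SG n (sum_rel R Q).
Proof.
elim: n R Q => [|n IHn] R Q bfR bfQ; split=> //;
  try exact: tree_sum_partial_iso (back_forth_iso bfR) (back_forth_iso bfQ).
have [_ [forthR backR]] := bfR; have [_ [forthQ backQ]] := bfQ.
have sub (P P' : TF -> SG -> Prop) := @back_forth_sub _ TF SG n P P'.
split=> [[x|x]|[y|y]].
- have [y Hy] := forthR x; exists (inl y).
  apply: sub (IHn _ _ Hy (back_forthW bfQ)) => -[x'|x'] [y'|y'] [|[]] //=.
  + by left.
  + by move=> [->] [->]; right.
- have [y Hy] := forthQ x; exists (inr y).
  apply: sub (IHn _ _ (back_forthW bfR) Hy) => -[x'|x'] [y'|y'] [|[]] //=.
  + by left.
  + by move=> [->] [->]; right.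
- have [x Hx] := backR y; exists (inl x).
  apply: sub (IHn _ _ Hx (back_forthW bfQ)) => -[x'|x'] [y'|y'] [|[]] //=.
  + by left.
  + by move=> [->] [->]; right.
- have [x Hx] := backQ y; exists (inr x).
  apply: sub (IHn _ _ (back_forthW bfR) Hx) => -[x'|x'] [y'|y'] [|[]] //=.
  + by left.
  + by move=> [->] [->]; right.
Qed.

End TreeSum.

Theorem lemma3p1 (L1 L2 : language) (T S : structure L1) (F G : structure L2)
    (A : set T) (B : set S) (n : nat) :
  is_tree T -> is_tree S -> is_forest F -> is_forest G ->
  is_path T A -> is_path S B ->
  elem_equiv n (expand T A) (expand S B) ->
  elem_equiv n F G ->
  elem_equiv n (expand (tree_sum T A F) (inl @` A))
               (expand (tree_sum S B G) (inl @` B)).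
Proof.
move=> _ _ _ _ _ _ /elem_equiv_back_forth TS /elem_equiv_back_forth FG.
apply/elem_equiv_back_forth; apply: back_forth_sub (tree_sum_back_forth TS FG).
(* Each constant of the sum comes from one summand, so the opening position lies in the sum of the
   two opening positions. *)
by move=> _ _ [[c|c] [-> ->]]; exists c.
Qed.
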